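(* Let $\vdash$ be a logic that is not graph-based. If there are two distinct formulas $\varphi$ and $\psi$ that are logically equivalent in $\vdash$ and satisfy $\mathrm{Var}(\varphi) \cup \mathrm{Var}(\psi) = \{ x \}$ for some variable $x$, then $\vdash$ has an algebraic semantics.
   Context: An algebraic language $\mathscr{L}$ is a set of connectives (function symbols) with finite arities; constants are $0$-ary connectives. $Fm$ denotes the set of $\mathscr{L}$-formulas built from a denumerable set $\mathrm{Var}$ of variables, and $\boldsymbol{Fm}$ the corresponding absolutely free algebra. A logic $\vdash$ is a (Tarskian) consequence relation on $Fm$, for some language $\mathscr{L}_{\vdash}$, that is substitution invariant: $\Gamma \vdash \varphi$ implies $\sigma[\Gamma] \vdash \sigma(\varphi)$ for every endomorphism $\sigma$ of $\boldsymbol{Fm}$. $\Gamma \dashv\vdash \Delta$ means $\Gamma \vdash \delta$ for all $\delta\in\Delta$ and $\Delta \vdash \gamma$ for all $\gamma \in \Gamma$. $\mathrm{Var}(\varphi)$ is the set of variables occurring in $\varphi$. Two formulas $\varphi,\psi$ are logically equivalent in $\vdash$ if $\delta(\varphi,\vec{z}) \dashv\vdash \delta(\psi,\vec{z})$ for every formula $\delta(v,\vec{z})$. A language (or a logic formulated in it) is graph-based if all its connectives have arity at most $1$ and it has at most one unary connective. For a set of equations $\boldsymbol{\tau}(x)$ in one variable $x$, $\boldsymbol{\tau}(\varphi)$ is the set of equations obtained by substituting $\varphi$ for $x$, and $\boldsymbol{\tau}[\Gamma] = \bigcup_{\gamma\in\Gamma}\boldsymbol{\tau}(\gamma)$. For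 a class $\mathsf{K}$ of algebras, $\Theta \vDash_{\mathsf{K}} \epsilon \approx \delta$ means that for every $\boldsymbol{A} \in \mathsf{K}$ and homomorphism $h\colon \boldsymbol{Fm}\to\boldsymbol{A}$, if $h(\varphi)=h(\psi)$ for all $\varphi\approx\psi\in\Theta$ then $h(\epsilon)=h(\delta)$. A logic $\vdash$ has an algebraic semantics if there are a set of equations $\boldsymbol{\tau}(x)$ and a class $\mathsf{K}$ of $\mathscr{L}_\vdash$-algebras such that for all $\Gamma\cup\{\varphi\}\subseteq Fm$: $\Gamma\vdash\varphi$ iff $\boldsymbol{\tau}[\Gamma]\vDash_{\mathsf{K}}\boldsymbol{\tau}(\varphi)$ (then $\mathsf{K}$ is a $\boldsymbol{\tau}$-algebraic semantics). *)

(* Defs.v *)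
From mathcomp Require Import all_boot.
From mathcomp Require Import boolp classical_sets.

Set Implicit Arguments.
Unset Strict Implicit.
Unset Printing Implicit Defensive.

Local Open Scope classical_set_scope.

Record language := Language {
  conn : Type;
  arity : conn -> nat
}.

Record algebra (L : language) := Algebra {
  carrier :> Type;
  op : forall c : conn L, ('I_(arity c) -> carrier) -> carrier
}.

Definition is_hom (L : language) (A B : algebra L) (h : A -> B) : Prop :=
  forall (c : conn L) (a : 'I_(arity c) -> A),
    h (op (c := c) a) = op (c := c) (fun i => h (a i)).

Definition var : Type := nat.

Inductive formula (L : language) : Type :=
  | FVar of var
  | FApp (c : conn L) of 'I_(arity c) -> formula L.

Definition Fm (L : language) : algebra L := Algebra (@FApp L).

Fixpoint Var (L : language) (f : formula L) : set var :=
  match f with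
  | FVar y => [set y]
  | FApp c a => [set y | exists i : 'I_(arity c), Var (a i) y]
  end.

(* [replace v f d] is d(f, z), where d = d(v, z): every occurrence of v in d
   becomes f, and all other variables are left unchanged. *)
Fixpoint replace (L : language) (v : var) (f d : formula L) : formula L :=
  match d with
  | FVar y => if y == v then f else FVar L y
  | FApp c a => FApp (fun i => replace v f (a i))
  end.

(* Monotonicity follows from [entails_refl] and [entails_cut]. Finitarity is
   not required. *)
Record logic (L : language) := Logic {
  entails : set (Fm L) -> Fm L -> Prop;
  entails_refl : forall (G : set (Fm L)) (f : Fm L), G f -> entails G f;
  entails_cut : forall (G D : set (Fm L)) (f : Fm L),
    (forall g, D g -> entails G g) -> entails D f -> entails G f;
  entails_subst : forall (s : Fm L -> Fm L) (G : set (Fm L)) (f : Fm L),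
    is_hom s -> entails G f -> entails (s @` G) (s f)
}.

Definition interderivable (L : language) (l : logic L) (G D : set (Fm L)) :
    Prop :=
  (forall d, D d -> entails l G d) /\ (forall g, G g -> entails l D g).

Definition logically_equivalent (L : language) (l : logic L) (f g : Fm L) :
    Prop :=
  forall (d : Fm L) (v : var),
    interderivable l [set replace v f d] [set replace v g d].

Definition graph_based (L : language) : Prop :=
  (forall c : conn L, arity c <= 1) /\
  (forall c d : conn L, arity c = 1 -> arity d = 1 -> c = d).

Definition equation (L : language) : Type := (Fm L * Fm L)%type.

Definition equations_in (L : language) (x : var) (tau : set (equation L)) :
    Prop :=
  forall e, tau e -> Var e.1 `|` Var e.2 `<=` [set x].

Definition eqs_at (L : language) (x : var) (tau : set (equation L))
    (f : Fm L) : set (equation L) :=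
  [set (replace x f e.1, replace x f e.2) | e in tau].

Definition eqs_image (L : language) (x : var) (tau : set (equation L))
    (G : set (Fm L)) : set (equation L) :=
  \bigcup_(g in G) eqs_at x tau g.

Definition eq_entails (L : language) (K : algebra L -> Prop)
    (Th : set (equation L)) (e : equation L) : Prop :=
  forall (A : algebra L) (h : Fm L -> A), K A -> is_hom h ->
    (forall t, Th t -> h t.1 = h t.2) -> h e.1 = h e.2.

Definition algebraic_semantics (L : language) (l : logic L) (x : var)
    (tau : set (equation L)) (K : algebra L -> Prop) : Prop :=
  forall (G : set (Fm L)) (f : Fm L),
    entails l G f <->
    (forall e, eqs_at x tau f e -> eq_entails K (eqs_image x tau G) e).

Definition has_algebraic_semantics (L : language) (l : logic L) : Prop :=
  exists (x : var) (tau : set (equation L)) (K : algebra L -> Prop),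
    equations_in x tau /\ algebraic_semantics l x tau K.

(* Main.v *)
Require Import Defs.
From mathcomp Require Import all_boot zify.
From mathcomp Require Import boolp classical_sets.

Set Implicit Arguments.
Unset Strict Implicit.
Unset Printing Implicit Defensive.

Local Open Scope classical_set_scope.

(** Choose one-variable formulas [eps] and [delta], logically equivalent and
    obtained by wrapping [phi] and [psi] in a large context, such that no
    instance of [delta] is an instance of [eps], of a non-variable subformula
    of [eps], or of a proper non-variable subformula of [delta]. For a theory
    [T], change the operations of the term algebra so that whenever they would
    output [delta(f)] with [f] in [T], they output [eps(f)] instead. A
    homomorphism [h] from the term algebra to the changed one satisfies
    [eps(f) = delta(f)] exactly when [h f] lies in [T]. As [delta(f)] was
    replaced by a logically equivalent formula, [h f] lies in [T] iff [s f]
    does, [s] being the substitution that agrees with [h] on variables. Hence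
    these algebras form an algebraic semantics for the equation
    [eps = delta]. *)

(** * Formulas and substitutions *)

Lemma FApp_inj_conn (L : language) (c c' : conn L)
    (a : 'I_(arity c) -> formula L) (b : 'I_(arity c') -> formula L) :
  FApp a = FApp b -> c = c'.
Proof. by case. Qed.

(** [same] compares arguments along a cast of ordinals. The cast keeps values, so it disappears
    whichever proof of [c = c] it carries. *)
Lemma FApp_inj_args (L : language) (c : conn L)
    (a b : 'I_(arity c) -> formula L) : FApp a = FApp b -> a = b.
Proof.
move=> eq_ab.
pose same (t : formula L) := if t is FApp c' b' then
  exists e : c = c', forall i, a i = b' (cast_ord (congr1 (@arity L) e) i)
  else False.
have [e eq_e] : same (FApp b).
  by rewrite -eq_ab; exists erefl => i; rewrite cast_ord_id.
apply/funext => i; rewrite eq_e; congr b.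
by apply/val_inj.
Qed.

Fixpoint subst (L : language) (s : var -> formula L) (t : formula L) :
    formula L :=
  match t with
  | FVar y => s y
  | FApp c a => FApp (fun i => subst s (a i))
  end.

Lemma subst_hom (L : language) (s : var -> formula L) :
  @is_hom L (Fm L) (Fm L) (subst s).
Proof. by []. Qed.

Lemma subst_FVar (L : language) (t : formula L) : subst (@FVar L) t = t.
Proof. by elim: t => //= c a IH; congr FApp; apply/funext. Qed.

Lemma replace_replace (L : language) (x : var) (f g t : formula L) :
  replace x f (replace x g t) = replace x (replace x f g) t.
Proof.
elim: t => [y|c a IH] /=; first by case: eqP => //= /eqP/negPf ->.
by congr FApp; apply/funext.
Qed.

Lemma replace_notin (L : language) (x : var) (f t : formula L) :
  ~ Var t x -> replace x f t = t.
Proof.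
elim: t => [y|c a IH] /= xt; first by case: eqP => // yx; case: xt.
congr FApp; apply/funext => i; apply: IH => xa; apply: xt; by exists i.
Qed.

Lemma replace_inj (L : language) (x : var) (f g t : formula L) :
  Var t x -> replace x f t = replace x g t -> f = g.
Proof.
elim: t => [y|c a IH] /=; first by move=> <-; rewrite eqxx.
by move=> [i xa] /FApp_inj_args /(congr1 (fun h => h i)); apply: IH.
Qed.

Lemma Var_replace (L : language) (x : var) (f t : formula L) :
  Var t x -> Var f x -> Var (replace x f t) x.
Proof.
elim: t => [y|c a IH] /=; first by move=> <-; rewrite eqxx.
by move=> [i xa] xf; exists i; apply: IH.
Qed.

Lemma Var_replace_sub (L : language) (x : var) (f t : formula L) :
  Var t `<=` [set x] -> Var f `<=` [set x] ->
  Var (replace x f t) `<=` [set x].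
Proof.
move=> + xf; elim: t => [y|c a IH] /= xt; first by case: eqP.
by move=> z /= [i]; apply: IH => w /= ?; apply: xt; exists i.
Qed.

(** A constant gets depth 1, so depth 0 singles out the variables. *)
Fixpoint depth (L : language) (t : formula L) : nat :=
  match t with
  | FVar _ => 0
  | FApp c a => (\max_(i < arity c) depth (a i)).+1
  end.

Lemma depth_arg (L : language) (c : conn L) (a : 'I_(arity c) -> formula L)
    (i : 'I_(arity c)) : depth (a i) < depth (FApp a).
Proof. by rewrite /= ltnS; apply: (leq_bigmax (F := fun i => depth (a i))). Qed.

Lemma depth_replace_ub (L : language) (x : var) (f t : formula L) :
  depth (replace x f t) <= depth f + depth t.
Proof.
elim: t => [y|c a IH]; first by rewrite /=; case: eqP => //=; lia.
rewrite [replace _ _ _]/= [depth (FApp _)]/= [depth (FApp a)]/= addnS ltnS.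
apply/bigmax_leqP => i _; apply: leq_trans (IH i) _.
by have := depth_arg a i; rewrite /=; lia.
Qed.

Lemma depth_replace_lb (L : language) (x : var) (f t : formula L) :
  Var t x -> depth f <= depth (replace x f t).
Proof.
elim: t => [y|c a IH] /=; first by move=> <-; rewrite eqxx.
move=> [i /IH le_i]; apply: leq_trans le_i _.
exact/ltnW/(depth_arg (fun i => replace x f (a i))).
Qed.

(** * Compatibility with a theory *)

Definition upd (n : nat) (T : Type) (a : 'I_n -> T) (i : 'I_n) (t : T) :
  'I_n -> T := fun j => if j == i then t else a j.

Inductive is_context (L : language) : (formula L -> formula L) -> Prop :=
  | context_hole : is_context id
  | context_app (c : conn L) (a : 'I_(arity c) -> formula L)
      (i : 'I_(arity c)) (F : formula L -> formula L) :
      is_context F -> is_context (fun t => FApp (upd a i (F t))).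

Lemma context_comp_app (L : language) (F : formula L -> formula L)
    (c : conn L) (a : 'I_(arity c) -> formula L) (i : 'I_(arity c)) :
  is_context F -> is_context (fun t => F (FApp (upd a i t))).
Proof.
elim=> [|c' a' i' {}F _ IH]; first exact/context_app/context_hole.
exact: (context_app a' i' IH).
Qed.

(** The Leibniz congruence of [T]: the largest congruence of the term algebra compatible with
    [T]. *)
Definition leibniz (L : language) (T : set (Fm L)) (t u : formula L) : Prop :=
  forall F, is_context F -> T (F t) <-> T (F u).

Lemma leibniz_refl (L : language) (T : set (Fm L)) (t : formula L) :
  leibniz T t t.
Proof. by []. Qed.

Lemma leibniz_sym (L : language) (T : set (Fm L)) (t u : formula L) :
  leibniz T t u -> leibniz T u t.
Proof. by move=> tu F /tu ?; apply: iff_sym. Qed.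

Lemma leibniz_trans (L : language) (T : set (Fm L)) (t u v : formula L) :
  leibniz T t u -> leibniz T u v -> leibniz T t v.
Proof. by move=> tu uv F cF; apply: iff_trans (tu F cF) (uv F cF). Qed.

Lemma leibniz_compat (L : language) (T : set (Fm L)) (t u : formula L) :
  leibniz T t u -> T t <-> T u.
Proof. by move=> /(_ _ (context_hole L)). Qed.

(** Exchange the arguments one at a time: [mix k] takes the first [k] from [b], and consecutive
    mixtures differ in a single hole. *)
Lemma leibniz_app (L : language) (T : set (Fm L)) (c : conn L)
    (a b : 'I_(arity c) -> formula L) :
  (forall i, leibniz T (a i) (b i)) -> leibniz T (FApp a) (FApp b).
Proof.
move=> ab.
pose mix k (i : 'I_(arity c)) := if i < k then b i else a i.
have mixP k : k <= arity c -> leibniz T (FApp a) (FApp (mix k)).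
  elim: k => [|k IH] kn.
    by rewrite (_ : mix 0 = a) //; apply/funext.
  apply: leibniz_trans (IH (ltnW kn)) _ => F cF.
  pose i := Ordinal kn.
  have -> : mix k = upd (mix k) i (a i).
    apply/funext => j; rewrite /upd; case: eqP => // ->.
    by rewrite /mix /= ltnn.
  have -> : mix k.+1 = upd (mix k) i (b i).
    apply/funext => j; rewrite /upd /mix ltnS leq_eqVlt -val_eqE /=.
    by case: eqP => //= jk; congr b; apply/val_inj.
  exact: ab (context_comp_app _ _ cF).
rewrite (_ : b = mix (arity c)); first exact: mixP.
by apply/funext => i; rewrite /mix ltn_ord.
Qed.

Definition is_theory (L : language) (l : logic L) (T : set (Fm L)) : Prop :=
  forall f, entails l T f -> T f.

Lemma consequences_theory (L : language) (l : logic L) (G : set (Fm L)) :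
  is_theory l [set f | entails l G f].
Proof. by move=> f /=; apply: entails_cut. Qed.

Definition unshift (L : language) (x : var) (A : formula L) (z : var) :
  formula L := if z == x then A else FVar L (unbump x z).

(* The other variables of the context are moved out of the way of [x] with
   [bump x], so that instantiating [x] afterwards only affects the hole. *)
Lemma context_template (L : language) (x : var) (A : formula L)
    (F : formula L -> formula L) : is_context F ->
  exists d, forall f,
    subst (unshift x A) (replace x f d) = F (subst (unshift x A) f).
Proof.
elim=> [|c a i {}F _ [d dF]]; first by exists (FVar L x) => f; rewrite /= eqxx.
pose ren := subst (fun z => FVar L (bump x z)).
exists (FApp (upd (fun j => ren (a j)) i d)) => f /=.
congr FApp; apply/funext => j; rewrite /upd; case: eqP => // _.
elim: (a j) => [y|c' a' IH] /=; last by congr FApp; apply/funext.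
have /negPf xy : bump x y != x by rewrite eq_sym neq_bump.
by rewrite xy /= /unshift xy bumpK.
Qed.

Lemma replace_subst (L : language) (x : var) (s : var -> formula L)
    (t : formula L) :
  Var t `<=` [set x] -> subst s t = replace x (s x) t.
Proof.
elim: t => [y|c a IH] /= xt; first by rewrite (xt y erefl : y = x) eqxx.
by congr FApp; apply/funext => i; apply: IH => z ?; apply: xt; exists i.
Qed.

(** For a context [F], a single substitution sends [d(phi)] and [d(psi)], for a template [d], to
    [F(phi(A))] and [F(psi(A))]. Substitution invariance then carries interderivability over to
    these. *)
Lemma leibniz_instances (L : language) (l : logic L) (phi psi : Fm L)
    (x : var) (T : set (Fm L)) (A : formula L) :
  logically_equivalent l phi psi ->
  Var phi `<=` [set x] -> Var psi `<=` [set x] -> is_theory l T ->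
  leibniz T (replace x A phi) (replace x A psi).
Proof.
move=> eqv xphi xpsi thT F cF.
have [d dF] := context_template x A cF.
pose s := unshift x A.
have sE t : Var t `<=` [set x] -> F (replace x A t) = subst s (replace x t d).
  by move=> xt; rewrite dF (replace_subst _ xt) /unshift eqxx.
have transfer f g : entails l [set replace x f d] (replace x g d) ->
    T (subst s (replace x f d)) -> T (subst s (replace x g d)).
  move=> /(entails_subst (@subst_hom L s)) ent Tf; apply: thT.
  apply: entails_cut ent => _ [_ -> <-]; exact: entails_refl.
have [to from] := eqv d x.
by rewrite !sE //; split; apply: transfer; [apply: to|apply: from].
Qed.

(** * The modified term algebra *)

(** Variables are exempt, since every formula is an instance of [x]. With the instances of [delta]
    as [P], evaluating [s] in the modified algebra never meets a changed value. *)
Fixpoint reduced (L : language) (P : set (formula L)) (x : var)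
    (s : formula L) : Prop :=
  match s with
  | FVar _ => True
  | FApp c a => (forall f, ~ P (FApp (fun i => replace x f (a i)))) /\
                (forall i, reduced P x (a i))
  end.

Definition instances (L : language) (x : var) (d : formula L) :
  set (formula L) := [set replace x f d | f in setT].

(** The choice of [f] is harmless: when [x] occurs in [delta], [f] is determined by [delta(f)]. *)
Definition mod_op (L : language) (x : var) (eps delta : formula L)
    (T : set (Fm L)) (c : conn L) (a : 'I_(arity c) -> formula L) :
    formula L :=
  if pselect (exists2 f, T f & FApp a = replace x f delta) is left w
  then replace x (s2val (cid2 w)) eps else FApp a.

Definition mod_algebra (L : language) (x : var) (eps delta : formula L)
  (T : set (Fm L)) : algebra L := Algebra (mod_op x eps delta T).

Lemma mod_op_in (L : language) (x : var) (eps delta : formula L)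
    (T : set (Fm L)) (c : conn L) (a : 'I_(arity c) -> formula L)
    (f : formula L) :
  Var delta x -> FApp a = replace x f delta -> T f ->
  mod_op x eps delta T a = replace x f eps.
Proof.
move=> xd af Tf; rewrite /mod_op; case: pselect => [w|[]]; last by exists f.
case: (cid2 w) => g _ ag /=; congr replace.
by apply: replace_inj xd _; rewrite -ag.
Qed.

Lemma mod_op_notin (L : language) (x : var) (eps delta : formula L)
    (T : set (Fm L)) (c : conn L) (a : 'I_(arity c) -> formula L) :
  (forall f, T f -> FApp a <> replace x f delta) ->
  mod_op x eps delta T a = FApp a.
Proof.
move=> na; rewrite /mod_op; case: pselect => // w.
by have [f /na] := w.
Qed.

Lemma mod_hom_reduced (L : language) (x : var) (eps delta : formula L)
    (T : set (Fm L)) (h : Fm L -> mod_algebra x eps delta T)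
    (s f : formula L) :
  is_hom h -> Var s `<=` [set x] -> reduced (instances x delta) x s ->
  h (replace x f s) = replace x (h f) s.
Proof.
move=> hh; elim: s => [y|c a IH] /= xs; first by rewrite (xs y erefl : y = x) eqxx.
move=> [nP ra]; rewrite (hh c) /=.
rewrite (_ : (fun i => h _) = fun i => replace x (h f) (a i)); last first.
  by apply/funext => i; apply: IH => // z ?; apply: xs; exists i.
by apply: mod_op_notin => g _ E; apply: (nP (h f)); exists g.
Qed.

(** By induction: each modified operation either agrees with the term operation or replaces
    [delta(f)] by the congruent [eps(f)]. *)
Lemma mod_hom_leibniz (L : language) (x : var) (eps delta : formula L)
    (T : set (Fm L)) (h : Fm L -> mod_algebra x eps delta T) (t : formula L) :
  (forall f, leibniz T (replace x f eps) (replace x f delta)) ->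
  is_hom h -> leibniz T (h t) (subst (fun y => h (FVar L y)) t).
Proof.
move=> eqv hh; elim: t => [y|c a IH] //=.
rewrite (hh c) /=; apply: leibniz_trans (leibniz_app IH).
have [w|nw] := pselect (exists2 f, T f & FApp (fun i => h (a i)) = replace x f delta).
  rewrite /mod_op; case: pselect => // w'; case: (cid2 w') => f _ /= ->.
  exact: eqv.
by rewrite mod_op_notin // => f Tf E; apply: nw; exists f.
Qed.

(** The homomorphism into the modified algebra that fixes the variables; its associated substitution
    is the identity. *)
Fixpoint mod_eval (L : language) (x : var) (eps delta : formula L)
    (T : set (Fm L)) (t : formula L) : formula L :=
  match t with
  | FVar y => FVar L y
  | FApp c a => mod_op x eps delta T (fun i => mod_eval x eps delta T (a i))
  end.

Lemma reduced_algebraic_semantics (L : language) (l : logic L) (x : var)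
    (eps : formula L) (c : conn L) (d : 'I_(arity c) -> formula L) :
  Var eps `<=` [set x] -> Var (FApp d) `<=` [set x] -> Var (FApp d) x ->
  (forall T f, is_theory l T ->
     leibniz T (replace x f eps) (replace x f (FApp d))) ->
  (forall f g, replace x f eps <> replace x g (FApp d)) ->
  reduced (instances x (FApp d)) x eps ->
  (forall i, reduced (instances x (FApp d)) x (d i)) ->
  has_algebraic_semantics l.
Proof.
set delta := FApp d => xeps xdelta xd eqv neq reps rd.
pose K A := exists2 T, is_theory l T & A = mod_algebra x eps delta T.
(* The left side evaluates to [eps(h f)]. The right side does too if [h f] is in [T]; otherwise it
   is [delta(h f)], which differs by [neq]. *)
have solve T (h : Fm L -> mod_algebra x eps delta T) f : is_hom h ->
    is_theory l T ->
    h (replace x f eps) = h (replace x f delta) <->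
    T (subst (fun y => h (FVar L y)) f).
  move=> hh thT.
  rewrite -(leibniz_compat (mod_hom_leibniz f (fun g => eqv T g thT) hh)).
  rewrite (mod_hom_reduced _ hh xeps reps) /= (hh c) /=.
  rewrite (_ : (fun i => h _) = fun i => replace x (h f) (d i)); last first.
    apply/funext => i; apply: mod_hom_reduced => // z ?.
    by apply: xdelta; exists i.
  split=> [|Tf]; last by rewrite (mod_op_in _ xd _ Tf).
  case: (pselect (T (h f))) => // nT.
  rewrite mod_op_notin; first by move/neq.
  by move=> g Tg E; apply: nT; rewrite (replace_inj xd (E : replace x (h f) delta = _)).
exists x, [set (eps, delta)], K; split; first by move=> _ -> z [/xeps|/xdelta].
move=> G f; split=> [Gf _ [_ -> <-] A h [T thT eA] |].
  subst A => hh hG; apply/(solve T) => //; apply: (thT).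
  apply: entails_cut (entails_subst (@subst_hom L (fun y => h (FVar L y))) Gf).
  move=> _ [g Gg <-]; apply: entails_refl; apply/(solve T) => //.
apply: (hG (replace x g eps, replace x g delta)).
  by exists g => //; exists (eps, delta).
(* Conversely, apply the semantics to the theory generated by [G] and to [mod_eval]: the conclusion
   then puts [f] into that theory. *)
move=> sem; pose T : set (Fm L) := [set g | entails l G g].
have thT : is_theory l T by apply: consequences_theory.
pose h : Fm L -> mod_algebra x eps delta T := mod_eval x eps delta T.
have hh : is_hom h by [].
suff: T (subst (fun y => h (FVar L y)) f) by rewrite subst_FVar.
apply/(solve T) => //.
apply: (sem (replace x f eps, replace x f delta)) => //.
- by exists (eps, delta).
- by exists T.
move=> _ [g Gg [_ -> <-]] /=; apply/(solve T) => //.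
by rewrite subst_FVar; apply: entails_refl.
Qed.

(** * A connective of arity at least two *)

Definition diag (L : language) (c : conn L) (t : formula L) : formula L :=
  FApp (fun _ : 'I_(arity c) => t).

Definition tower (L : language) (c : conn L) (n : nat) (t : formula L) :
  formula L := iter n (diag c) t.

Lemma replace_tower (L : language) (c : conn L) (n : nat) (x : var)
    (f t : formula L) :
  replace x f (tower c n t) = tower c n (replace x f t).
Proof. by elim: n => //= n ->. Qed.

Lemma diag_inj (L : language) (c : conn L) : 0 < arity c -> injective (diag c).
Proof. by move=> c0 t u /FApp_inj_args /(congr1 (fun h => h (Ordinal c0))). Qed.

Lemma tower_inj (L : language) (c : conn L) (n : nat) :
  0 < arity c -> injective (tower c n).
Proof. by move=> c0; elim: n => //= n IH t u /(diag_inj c0)/IH. Qed.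

Lemma depth_tower (L : language) (c : conn L) (n : nat) (t : formula L) :
  0 < arity c -> depth (tower c n t) = n + depth t.
Proof.
move=> c0; elim: n => //= n IH; rewrite addSn -IH; congr S; apply/eqP; rewrite eqn_leq.
apply/andP; split; first exact/bigmax_leqP.
exact: (leq_bigmax (F := fun=> _) (Ordinal c0)).
Qed.

Lemma Var_tower (L : language) (c : conn L) (n : nat) (t : formula L) :
  0 < arity c -> Var (tower c n t) = Var t.
Proof.
move=> c0; elim: n => //= n IH; rewrite -IH; apply/seteqP; split=> z /=.
  by case.
by move=> ?; exists (Ordinal c0).
Qed.

(** If [x] occurs in the application, the result is strictly deeper than [f]; otherwise it is
    unchanged and too shallow. *)
Lemma replace_app_neq (L : language) (x : var) (f : formula L) (c : conn L)
    (a : 'I_(arity c) -> formula L) :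
  depth (FApp a) < depth f -> replace x f (FApp a) <> f.
Proof.
move=> lt_af E; case: (pselect (Var (FApp a) x)) => [[i xi]|xa].
  have := depth_arg (fun i => replace x f (a i)) i.
  by have := depth_replace_lb f xi; rewrite -/(replace x f (FApp a)) E; lia.
by move: E lt_af; rewrite replace_notin // => <-; rewrite ltnn.
Qed.

Lemma replace_deep_inj (L : language) (x : var) (f t u : formula L) :
  Var t `<=` [set x] -> Var u `<=` [set x] ->
  depth t < depth f -> depth u < depth f ->
  replace x f t = replace x f u -> t = u.
Proof.
elim: t u => [y|c a IH] [z|c' b] xt xu lt lu.
- by rewrite (xt y erefl : y = x) (xu z erefl : z = x).
- rewrite [LHS]/= (xt y erefl : y = x) eqxx => /esym.
  by move/(replace_app_neq lu).
- rewrite [RHS]/= (xu z erefl : z = x) eqxx.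
  by move/(replace_app_neq lt).
move=> E; have ecc := FApp_inj_conn E; subst c'.
congr FApp; apply/funext => i; apply: IH.
- by move=> z zi; apply: xt; exists i.
- by move=> z zi; apply: xu; exists i.
- exact: ltn_trans (depth_arg a i) lt.
- exact: ltn_trans (depth_arg b i) lu.
exact: (congr1 (fun h => h i) (FApp_inj_args E)).
Qed.

(* [delta = c(u, psi(g), ..., psi(g))], where [u] and [g] are towers of [c]
   and [u] is much deeper than [g] and [psi]. An occurrence of [delta(f)] is
   recognised by the large gap between the depths of its first two arguments,
   which no other subformula of [eps] or [delta] has. *)
Lemma algebraic_semantics_multiary (L : language) (l : logic L)
    (phi psi : formula L) (x : var) (c : conn L) :
  1 < arity c -> phi <> psi ->
  Var phi `<=` [set x] -> Var psi `<=` [set x] -> Var psi x ->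
  (forall T f, is_theory l T ->
     leibniz T (replace x f phi) (replace x f psi)) ->
  has_algebraic_semantics l.
Proof.
move=> c1 neq xphi xpsi xinpsi eqv.
have c0 : 0 < arity c by apply: ltnW.
pose D := maxn (depth phi) (depth psi).
have phiD : depth phi <= D by apply: leq_maxl.
have psiD : depth psi <= D by apply: leq_maxr.
(* [k > D] makes [tower c k f] deep enough for [replace_deep_inj]. [M] outweighs the inner tower
   together with two formulas of depth at most [D]. *)
pose k := D.+1; pose M := (k + D + D).+1.
pose g := tower c k (FVar L x); pose u := tower c M (FVar L x).
pose args t := fun i : 'I_(arity c) => if val i == 0 then u else replace x g t.
have gE f : replace x f g = tower c k f by rewrite replace_tower /= eqxx.
have uE f : replace x f u = tower c M f by rewrite replace_tower /= eqxx.
have args0 t f : replace x f (args t (Ordinal c0)) = tower c M f by [].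
have args1 t f : replace x f (args t (Ordinal c1)) = replace x (tower c k f) t.
  by rewrite /= replace_replace gE.
have xg : Var g = [set x] by rewrite Var_tower.
have xu : Var u = [set x] by rewrite Var_tower.
have Var_args t : Var t `<=` [set x] -> Var (FApp (args t)) `<=` [set x].
  move=> xt z /= [i]; rewrite /args; case: ifP => _; first by rewrite xu.
  by apply: Var_replace_sub => //; rewrite xg.
have redexP (a : 'I_(arity c) -> formula L) :
    instances x (FApp (args psi)) (FApp a) ->
    exists2 f, a (Ordinal c0) = tower c M f &
               a (Ordinal c1) = replace x (tower c k f) psi.
  move=> [f _ /FApp_inj_args E]; exists f; rewrite -E.
    exact: args0.
  exact: args1.
have redex_conn c' (a : 'I_(arity c') -> formula L) :
    instances x (FApp (args psi)) (FApp a) -> c = c'.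
  by move=> [f _ /FApp_inj_conn].
have depth_psi f : k + depth f <= depth (replace x (tower c k f) psi)
    <= k + depth f + D.
  have := depth_replace_lb (tower c k f) xinpsi.
  have := depth_replace_ub x (tower c k f) psi.
  by rewrite depth_tower //; lia.
(* The arguments of a tower coincide, whereas the first two of an instance of [delta] differ in
   depth. *)
have reduced_tower n : reduced (instances x (FApp (args psi))) x
    (tower c n (FVar L x)).
  elim: n => //= n IH; split=> // f /redexP [h -> /(congr1 (@depth L))].
  by have := depth_psi h; rewrite depth_tower // /M; lia.
have reduced_repl t : depth t <= D ->
    reduced (instances x (FApp (args psi))) x (replace x g t).
  elim: t => [y|c' a IH] tD.
    rewrite [replace _ _ _]/=; case: eqP => // _; exact: reduced_tower.
  split=> [f|i]; last first.
    by apply: IH; have := depth_arg a i; lia.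
  move=> P; have ec := redex_conn _ _ P; subst c'.
  have [h] := redexP _ P; rewrite -/(replace x g _) !replace_replace gE.
  move=> /(congr1 (@depth L)) E0 /(congr1 (@depth L)) E1.
  have := depth_psi h.
  have := depth_replace_ub x (tower c k f) (a (Ordinal c0)).
  have := depth_arg a (Ordinal c0); have := depth_arg a (Ordinal c1).
  move: E0; rewrite !depth_tower // => ->.
  (* If [x] occurs in the second argument, then [depth f <= depth h + D], which leaves the first
     argument shallower than [M + depth h]. Otherwise the second argument is shallower than [k]. *)
  case: (pselect (Var (a (Ordinal c1)) x)) => [xa|xa].
    have := depth_replace_lb (tower c k f) xa.
    by rewrite E1 depth_tower // /M; lia.
  by move: E1; rewrite replace_notin // => ->; lia.
have reduced_args t i : depth t <= D ->
    reduced (instances x (FApp (args psi))) x (args t i).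
  by move=> tD; rewrite /args; case: ifP => _; [apply: reduced_tower|apply: reduced_repl].
have neq_inst f : ~ instances x (FApp (args psi)) (replace x f (FApp (args phi))).
  move=> /redexP [h].
  rewrite -!/(replace _ _ _) args0 args1 => /(tower_inj c0) -> E.
  apply: neq; apply: replace_deep_inj E => //; rewrite depth_tower //; lia.
apply: (reduced_algebraic_semantics (eps := FApp (args phi)) (d := args psi)).
- exact: Var_args.
- exact: Var_args.
- have xinu : Var u x by rewrite xu.
  by exists (Ordinal c0).
- move=> T f thT; apply: leibniz_app => i; rewrite -!/(replace _ _ _) /args.
  case: ifP => _; first exact: leibniz_refl.
  by rewrite !replace_replace; apply: eqv.
- by move=> f h E; apply: (neq_inst f); exists h.
- by split=> [//|i]; apply: reduced_args.
- by move=> i; apply: reduced_args.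
Qed.

(** * Two unary connectives *)

Fixpoint lead (L : language) (p : conn L) (t : formula L) : nat :=
  match t with
  | FVar _ => 0
  | FApp c a =>
      if `[< c = p >] then (\max_(i < arity c) lead p (a i)).+1 else 0
  end.

Lemma bigmax_unary (n : nat) (F : 'I_n -> nat) (i : 'I_n) :
  n = 1 -> \max_(j < n) F j = F i.
Proof. by move=> n1; subst n; rewrite big_ord1 [i]ord1. Qed.

Lemma lead_tower (L : language) (p : conn L) (n : nat) (t : formula L) :
  arity p = 1 -> lead p (tower p n t) = n + lead p t.
Proof.
move=> p1; elim: n => //= n IH; rewrite asboolT // addSn -IH; congr S.
have p0 : 0 < arity p by rewrite p1.
exact: (bigmax_unary (fun=> _) (Ordinal p0)).
Qed.

Lemma lead_diag_neq (L : language) (p q : conn L) (t : formula L) :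
  p <> q -> lead p (diag q t) = 0.
Proof. by move=> pq; rewrite /= asboolF // => qp; apply: pq. Qed.

(** Either [t] consists of [p]s down to [x], and these precede the [p]s of [f], or another
    connective within [t] stops the count. *)
Lemma lead_replace (L : language) (p : conn L) (x : var) (f t : formula L) :
  arity p = 1 -> Var t `<=` [set x] ->
  lead p (replace x f t) = lead p f + depth t \/
  lead p (replace x f t) < depth t.
Proof.
move=> p1; elim: t => [y|c a IH] xt.
  by rewrite /= (xt y erefl : y = x) eqxx addn0; left.
rewrite /=; case: asboolP => [ec|_]; last by right.
subst c; have p0 : 0 < arity p by rewrite p1.
rewrite !(bigmax_unary _ (Ordinal p0)) // addnS ltnS.
have [|->|] := IH (Ordinal p0); [|by left|by right].
by move=> z ?; apply: xt; exists (Ordinal p0).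
Qed.

(* Comparing numbers of leading [p]'s tells [p^k(q(f))] apart from
   [t(p^k(q(h)))] for every non-variable [t] of depth at most [k]. *)
Lemma replace_word_inj (L : language) (p q : conn L) (x : var) (k : nat)
    (f h t u : formula L) :
  (forall c : conn L, arity c <= 1) -> arity p = 1 -> p <> q ->
  Var t `<=` [set x] -> Var u `<=` [set x] -> Var u x ->
  depth t <= k -> depth u <= k ->
  replace x (tower p k (diag q f)) t = replace x (tower p k (diag q h)) u ->
  t = u.
Proof.
move=> ar1 p1 pq; set w := fun f => tower p k (diag q f).
have leadw g : lead p (w g) = k by rewrite lead_tower // lead_diag_neq // addn0.
have var_app g g' c (a : 'I_(arity c) -> formula L) :
    Var (FApp a) `<=` [set x] -> depth (FApp a) <= k ->
    replace x (w g) (FApp a) <> w g'.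
  move=> xa ak E; have a0 : 0 < depth (FApp a) by [].
  have := lead_replace (w g) p1 xa; rewrite E !leadw.
  by move: ak a0; set n := depth _; lia.
elim: t u => [y|c a IH] [z|c' b] xt xu xinu tk uk.
- by rewrite (xt y erefl : y = x) (xu z erefl : z = x).
- rewrite [LHS]/= (xt y erefl : y = x) eqxx => /esym.
  by move/(var_app _ _ _ _ xu uk).
- rewrite [RHS]/= (xu z erefl : z = x) eqxx.
  by move/(var_app _ _ _ _ xt tk).
move=> E; have ecc := FApp_inj_conn E; subst c'.
case: xinu => i xi; congr FApp; apply/funext => j.
have -> : j = i.
  have ord_eq0 (r : 'I_(arity c)) : val r = 0.
    by apply/eqP; rewrite -leqn0 -ltnS (leq_trans (ltn_ord r)).
  by apply/val_inj; rewrite !ord_eq0.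
apply: IH => //.
- by move=> z zi; apply: xt; exists i.
- by move=> z zi; apply: xu; exists i.
- by have := depth_arg a i; lia.
- by have := depth_arg b i; lia.
exact: (congr1 (fun h => h i) (FApp_inj_args E)).
Qed.

(* [delta = p^N(q(psi(p^k(q(x)))))] with [N] much larger than [k] and the
   depth of [psi]: an instance of [delta] has exactly [N] leading [p]'s, and
   instances of proper subformulas of [eps] and [delta] have fewer. *)
Lemma algebraic_semantics_unary (L : language) (l : logic L)
    (phi psi : formula L) (x : var) (p q : conn L) :
  (forall c : conn L, arity c <= 1) -> arity p = 1 -> arity q = 1 -> p <> q ->
  phi <> psi ->
  Var phi `<=` [set x] -> Var psi `<=` [set x] -> Var psi x ->
  (forall T f, is_theory l T ->
     leibniz T (replace x f phi) (replace x f psi)) ->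
  has_algebraic_semantics l.
Proof.
move=> ar1 p1 q1 pq neq xphi xpsi xinpsi eqv.
have p0 : 0 < arity p by rewrite p1.
have q0 : 0 < arity q by rewrite q1.
pose k := maxn (depth phi) (depth psi).
have phik : depth phi <= k by apply: leq_maxl.
have psik : depth psi <= k by apply: leq_maxr.
(* This bounds the leading [p]s of [t(p^k(q(f)))] for [t] of depth at most [k]; the outer towers of
   [eps] and [delta] therefore get height [N.+1]. *)
pose N := k + k.
pose g := tower p k (diag q (FVar L x)).
pose word n t := tower p n (diag q (replace x g t)).
have gE f : replace x f g = tower p k (diag q f) by rewrite replace_tower /= eqxx.
have xg : Var g = [set x].
  by rewrite Var_tower // -[diag _ _]/(tower q 1 _) Var_tower.
have Var_word n t : Var (word n t) = Var (replace x g t).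
  by rewrite Var_tower // -[diag _ _]/(tower q 1 _) Var_tower.
have wordE n t f :
    replace x f (word n t) = tower p n (diag q (replace x (tower p k (diag q f)) t)).
  by rewrite replace_tower /= replace_replace gE.
have lead_redex f : lead p (replace x f (word N.+1 psi)) = N.+1.
  by rewrite wordE lead_tower // lead_diag_neq // addn0.
have small_lead t : lead p t <= N -> ~ instances x (word N.+1 psi) t.
  by move=> tN [f _ E]; move: tN; rewrite -E lead_redex ltnn.
have reduced_repl t : Var t `<=` [set x] -> depth t <= k ->
    reduced (instances x (word N.+1 psi)) x (replace x g t).
  elim: t => [y|c a IH] xt tk.
    rewrite /= (xt y erefl : y = x) eqxx /g.
    have : k <= N by apply: leq_addr.
    elim: (k) => [_|n IHn nN].
      by split=> // f; apply: small_lead; rewrite /= asboolF // => qp; apply: pq.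
    split=> [f|_]; last exact/IHn/ltnW.
    apply: small_lead.
    rewrite -[FApp _]/(replace x f (tower p n.+1 (diag q (FVar L x)))).
    by rewrite replace_tower lead_tower // lead_diag_neq // addn0.
  split=> [f|i]; last first.
    apply: IH; first by move=> z zi; apply: xt; exists i.
    by have := depth_arg a i; lia.
  apply: small_lead.
  rewrite -[FApp _]/(replace x f (replace x g (FApp a))) replace_replace gE.
  have [->|] := lead_replace (tower p k (diag q f)) p1 xt; last by rewrite /N; lia.
  by rewrite lead_tower // lead_diag_neq // /N; lia.
have reduced_word n t : n <= N -> Var t `<=` [set x] -> depth t <= k ->
    reduced (instances x (word N.+1 psi)) x (word n t).
  move=> + xt tk; elim: n => [_|n IHn nN].
    split=> [f|_]; last exact: reduced_repl.
    by apply: small_lead; rewrite /= asboolF // => qp; apply: pq.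
  split=> [f|_]; last exact/IHn/ltnW.
  apply: small_lead; rewrite -[FApp _]/(replace x f (word n.+1 t)).
  by rewrite wordE lead_tower // lead_diag_neq // addn0.
(* Cancelling the outer [p]s and [q] leaves [phi(p^k(q(f))) = psi(p^k(q(h)))], whence [phi = psi]
   even for distinct [f] and [h]. *)
have neq_inst f h : replace x f (word N.+1 phi) <> replace x h (word N.+1 psi).
  rewrite !wordE => /(tower_inj p0)/(diag_inj q0) E.
  by apply: neq; apply: replace_word_inj E.
have Var_sub n t : Var t `<=` [set x] -> Var (word n t) `<=` [set x].
  by move=> xt; rewrite Var_word; apply: Var_replace_sub => //; rewrite xg.
apply: (reduced_algebraic_semantics (eps := word N.+1 phi)
          (d := fun _ : 'I_(arity p) => word N psi)).
- exact: Var_sub.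
- exact: (Var_sub N.+1 psi).
- rewrite -[FApp _]/(word N.+1 psi) Var_word.
  by apply: Var_replace => //; rewrite xg.
- move=> T f thT; rewrite -[FApp _]/(word N.+1 psi) !wordE.
  elim: N.+1 => [|n IHn]; apply: leibniz_app => i //.
  exact: eqv.
- exact: neq_inst.
(* [eps] itself has [N.+1] leading [p]s, so [neq_inst] rather than [small_lead] handles it. *)
- split=> [f|_]; last exact: reduced_word.
  by move=> [h _ E]; apply: (neq_inst f h).
- by move=> _; apply: reduced_word.
Qed.

(** * Case distinction on the arities of the connectives *)

Theorem theorem6p2 (L : language) (l : logic L)
  (not_graph : ~ graph_based L)
  (phi psi : Fm L) (x : var)
  (phi_neq_psi : phi <> psi)
  (phi_equiv_psi : logically_equivalent l phi psi)
  (vars_x : Var phi `|` Var psi = [set x]) :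
  has_algebraic_semantics l.
Proof.
have xphi : Var phi `<=` [set x] by rewrite -vars_x; apply: subsetUl.
have xpsi : Var psi `<=` [set x] by rewrite -vars_x; apply: subsetUr.
have eqv T f (thT : is_theory l T) :
    leibniz T (replace x f phi) (replace x f psi).
  exact: leibniz_instances thT.
(* [phi] and [psi] play symmetric roles, so [u] may be the one in which [x] occurs. *)
suff main t u : t <> u -> Var t `<=` [set x] -> Var u `<=` [set x] ->
    Var u x ->
    (forall T f, is_theory l T ->
       leibniz T (replace x f t) (replace x f u)) -> has_algebraic_semantics l.
  have [xin|xin] : (Var phi `|` Var psi) x by rewrite vars_x.
    apply: (main psi phi) => // [/esym//|T f thT].
    by apply: leibniz_sym; apply: eqv.
  exact: (main phi psi).
move=> neq xt xu xinu eqv'.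
have [[c c1]|ar1] := pselect (exists c : conn L, 1 < arity c).
  exact: (algebraic_semantics_multiary c1 neq xt xu xinu eqv').
have {}ar1 (c : conn L) : arity c <= 1.
  by rewrite leqNgt; apply/negP => c1; apply: ar1; exists c.
have [[p [q [p1 q1 pq]]]|uniq_unary] :=
  pselect (exists p q : conn L, [/\ arity p = 1, arity q = 1 & p <> q]).
  exact: (algebraic_semantics_unary ar1 p1 q1 pq neq xt xu xinu eqv').
case: not_graph; split=> // c d c1 d1.
by case: (pselect (c = d)) => // cd; case: uniq_unary; exists c, d.
Qed.
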